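(* Assume Assumption (I), and let $(L_k,u_k)$ be a sequence generated by Algorithm A. Let $\bar u\in V$ be the weak limit in $V$ of a subsequence of $(u_k)$. Then there exists $\bar\lambda\in V^*$ such that \[ \alpha\langle\bar u,v\rangle_V+\beta\langle\bar\lambda,v\rangle_{V^*,V}=-F'(\bar u)v\quad\forall v\in V, \qquad \langle\bar\lambda,\bar u\rangle_{V^*,V}\ge p\int_\Omega|\bar u|^p\,dx . \]
   Context: Standing assumptions: $\Omega\subset\mathbb R^d$ bounded Lipschitz domain; $V$ real Hilbert space with inner product $\langle\cdot,\cdot\rangle_V$, $V\subset L^2(\Omega)$ with compact and dense embedding; $V^*$ dual with pairing $\langle\cdot,\cdot\rangle_{V^*,V}$. $F:V\to\mathbb R$ weakly lower semicontinuous, bounded below by an affine function, continuously Fréchet differentiable. $\alpha>0$, $\beta>0$, $p\in(0,1)$. Assumption (I): the standing assumptions hold; $F'$ is completely continuous ($u_n\rightharpoonup u$ in $V$ implies $F'(u_n)\to F'(u)$ in $V^*$); and $F':V\to V^*$ is Lipschitz continuous on bounded sets. For $\epsilon>0$, $\psi_\epsilon(t)=\frac p2\frac{t}{\epsilon^{2-p}}+(1-\frac p2)\epsilon^p$ if $t\in[0,\epsilon^2)$, $\psi_\epsilon(t)=t^{p/2}$ if $t\ge\epsilon^2$, $\psi_\epsilon'(t)=\frac p2\min(\epsilon^{p-2},t^{(p-2)/2})$. Algorithm A: choose a monotonically decreasing sequence $\epsilon_k\searrow0$, constants $\gamma>1$, $\tilde L>0$, and $u_0\in V$. Given $u_k$,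 for $L\ge0$ let problem (Q$_{k,L}$) be $\min_{u\in V} F(u_k)+F'(u_k)(u-u_k)+\frac L2\|u-u_k\|_V^2+\frac\alpha2\|u\|_V^2+\beta\int_\Omega\big[\psi_{\epsilon_k}(u_k^2)+\psi_{\epsilon_k}'(u_k^2)(u^2-u_k^2)\big]dx$ (strongly convex, unique minimizer), and let (D$_{k,L}$) be the condition $F(u_{k+1})\le F(u_k)+F'(u_k)(u_{k+1}-u_k)+L\|u_{k+1}-u_k\|_V^2$ for its minimizer $u_{k+1}$. $L_k$ is the smallest $L\in\{0\}\cup\{\tilde L\gamma^l:l\ge0\}$ for which (D$_{k,L}$) holds, and $u_{k+1}$ is the corresponding minimizer; then $k\mapsto k+1$. *)

(* Defs.v *)
From HB Require Import structures.
From mathcomp Require Import all_boot all_order all_algebra.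
From mathcomp Require Import all_classical all_reals all_analysis.
Set Implicit Arguments. Unset Strict Implicit. Unset Printing Implicit Defensive.
Import Order.TTheory GRing.Theory Num.Theory.
Import numFieldNormedType.Exports.
Local Open Scope classical_set_scope.
Local Open Scope ring_scope.

Section Defs.
Context {R : realType}.

(* [ip] is a real inner product on V inducing the norm of V; since V is a
   complete normed space, (V, ip) is a real Hilbert space. *)
Definition is_hilbert_ip (V : completeNormedModType R) (ip : V -> V -> R) : Prop :=
  [/\ (forall u v, ip u v = ip v u),
      (forall a u w v, ip (a *: u + w) v = a * ip u v + ip w v)
    & (forall v, ip v v = `|v| ^+ 2)].

(* weak convergence u_n -> ubar in V (Riesz: test against all v in V) *)
Definition weak_cvg (V : completeNormedModType R) (ip : V -> V -> R)
  (u : nat -> V) (ubar : V) : Prop :=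
  forall v, (fun n => ip (u n) v) @ \oo --> ip ubar v.

Definition is_dual (V : completeNormedModType R) (l : V -> R) : Prop :=
  (forall a u w, l (a *: u + w) = a * l u + l w) /\
  (exists C : R, forall v, `|l v| <= C * `|v|).

Definition dual_cvg (V : completeNormedModType R) (ln : nat -> V -> R) (l : V -> R) : Prop :=
  forall e : R, 0 < e -> exists N : nat, forall n, (N <= n)%N ->
    forall v, `|ln n v - l v| <= e * `|v|.

Definition L2sq {d} {T : measurableType d} (mu : {measure set T -> \bar R})
  (f : T -> R) : R := Rintegral mu setT (fun x => f x ^+ 2).

Definition is_L2 {d} {T : measurableType d} (mu : {measure set T -> \bar R})
  (f : T -> R) : Prop :=
  measurable_fun setT f /\ mu.-integrable setT (fun x => (f x ^+ 2)%:E).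

(* [iota] realizes "V \subset L^2(Omega) with compact and dense embedding":
   linear, injective (into L^2, i.e. modulo null functions), continuous,
   compact, with dense range. *)
Definition compact_dense_embedding {d} {T : measurableType d}
  (mu : {measure set T -> \bar R}) (V : completeNormedModType R)
  (iota : V -> T -> R) : Prop :=
  (forall v, is_L2 mu (iota v)) /\
  [/\ (forall a u w x, iota (a *: u + w) x = a * iota u x + iota w x),
      (forall v, L2sq mu (iota v) = 0 -> v = 0),
      (exists C : R, forall v, L2sq mu (iota v) <= C * `|v| ^+ 2),
      (* compactness: every bounded sequence has a subsequence whose image
         is Cauchy (hence convergent) in L^2 *)
      (forall w : nat -> V, (exists M : R, forall n, `|w n| <= M) ->
         exists phi : nat -> nat, (forall n, (phi n < phi n.+1)%N) /\
           forall e : R, 0 < e -> exists N : nat, forall m n, (N <= m)%N -> (N <= n)%N ->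
             L2sq mu (fun x => iota (w (phi m)) x - iota (w (phi n)) x) < e)
    &
      (forall f : T -> R, is_L2 mu f -> forall e : R, 0 < e ->
         exists v, L2sq mu (fun x => iota v x - f x) < e)].

Definition weakly_lsc (V : completeNormedModType R) (ip : V -> V -> R) (F : V -> R) : Prop :=
  forall (u : nat -> V) (ubar : V), weak_cvg ip u ubar ->
    forall e : R, 0 < e -> exists N : nat, forall n, (N <= n)%N -> F ubar - e <= F (u n).

Definition bounded_below_affine (V : completeNormedModType R) (F : V -> R) : Prop :=
  exists (l : V -> R) (c : R), is_dual l /\ forall u, l u + c <= F u.

Definition cont_frechet (V : completeNormedModType R) (F : V -> R) (F' : V -> V -> R) : Prop :=
  [/\ (forall u, is_dual (F' u)),
      (forall u (e : R), 0 < e -> exists delta : R, 0 < delta /\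
         forall h, `|h| < delta -> `|F (u + h) - F u - F' u h| <= e * `|h|)
    & (forall u (e : R), 0 < e -> exists delta : R, 0 < delta /\
         forall w, `|w - u| < delta -> forall v, `|F' w v - F' u v| <= e * `|v|)].

Definition completely_continuous (V : completeNormedModType R) (ip : V -> V -> R)
  (F' : V -> V -> R) : Prop :=
  forall (u : nat -> V) (ubar : V), weak_cvg ip u ubar ->
    dual_cvg (fun n => F' (u n)) (F' ubar).

Definition lipschitz_on_bounded (V : completeNormedModType R) (F' : V -> V -> R) : Prop :=
  forall M : R, exists C : R, forall u w, `|u| <= M -> `|w| <= M ->
    forall v, `|F' u v - F' w v| <= C * `|u - w| * `|v|.

Definition psi (p eps t : R) : R :=
  if t < eps ^+ 2 then p / 2 * t / eps `^ (2 - p) + (1 - p / 2) * eps `^ p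
  else t `^ (p / 2).

(* psi'_eps(t) = p/2 * min(eps^(p-2), t^((p-2)/2)); the min equals
   eps^(p-2) exactly when t < eps^2 (with t^((p-2)/2) = +oo at t = 0). *)
Definition dpsi (p eps t : R) : R :=
  if t < eps ^+ 2 then p / 2 * eps `^ (p - 2) else p / 2 * t `^ ((p - 2) / 2).

Definition Qobj {d} {T : measurableType d} (mu : {measure set T -> \bar R})
  (V : completeNormedModType R) (iota : V -> T -> R) (F : V -> R) (F' : V -> V -> R)
  (alpha beta p eps : R) (uk : V) (L : R) (u : V) : R :=
  F uk + F' uk (u - uk) + L / 2 * `|u - uk| ^+ 2 + alpha / 2 * `|u| ^+ 2
  + beta * Rintegral mu setT (fun x =>
      psi p eps (iota uk x ^+ 2)
      + dpsi p eps (iota uk x ^+ 2) * (iota u x ^+ 2 - iota uk x ^+ 2)).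

Definition is_Qmin {d} {T : measurableType d} (mu : {measure set T -> \bar R})
  (V : completeNormedModType R) (iota : V -> T -> R) (F : V -> R) (F' : V -> V -> R)
  (alpha beta p eps : R) (uk : V) (L : R) (w : V) : Prop :=
  forall u, Qobj mu iota F F' alpha beta p eps uk L w
            <= Qobj mu iota F F' alpha beta p eps uk L u.

Definition condD (V : completeNormedModType R) (F : V -> R) (F' : V -> V -> R)
  (uk : V) (L : R) (w : V) : Prop :=
  F w <= F uk + F' uk (w - uk) + L * `|w - uk| ^+ 2.

Definition Lcand (Ltil gamma L : R) : Prop :=
  L = 0 \/ exists l : nat, L = Ltil * gamma ^+ l.

Definition algorithmA {d} {T : measurableType d} (mu : {measure set T -> \bar R})
  (V : completeNormedModType R) (iota : V -> T -> R) (F : V -> R) (F' : V -> V -> R)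
  (alpha beta p : R) (eps : nat -> R) (gamma Ltil : R)
  (Lk : nat -> R) (u : nat -> V) : Prop :=
  [/\ (forall k, 0 < eps k), (forall k, eps k.+1 <= eps k), eps @ \oo --> 0 &
      1 < gamma /\ 0 < Ltil] /\
      forall k,
        [/\ Lcand Ltil gamma (Lk k),
            is_Qmin mu iota F F' alpha beta p (eps k) (u k) (Lk k) (u k.+1),
            condD F F' (u k) (Lk k) (u k.+1)
          & forall L w, Lcand Ltil gamma L -> L < Lk k ->
              is_Qmin mu iota F F' alpha beta p (eps k) (u k) L w ->
              ~ condD F F' (u k) L w].

End Defs.

(* Main.v *)
(* Since psi_eps(t) is the minimum over m >= eps of the tangents of t |-> t^(p/2)
   at m^2, it is concave in t and monotone in eps; testing the optimality condition
   of the subproblem with the increment u_(k+1) - u_k then shows that the energies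
   F + alpha/2 |.|^2 + beta int psi_(eps_k) decrease by at least
   alpha/2 |u_(k+1) - u_k|^2. Hence the iterates are bounded and the increments tend
   to 0; the L_k are bounded because F' is Lipschitz on a ball containing all
   iterates and trial minimizers.

   The multiplier is defined by the limit equation, so only the inequality has
   content. Testing the optimality condition with u_(k+1) expresses
   2 beta int psi'_(eps_k)(u_k^2) u_(k+1)^2 through terms that pass to the limit. For
   the lower bound on this integral, Young's inequality with m = max(eps, |a|) gives,
   pointwise, p m^(p-2) b^2 >= 2 |b|^p - (2-p) m^p, and f |-> |f|^p is continuous from
   L^2 to L^1 on a finite measure space; as a, b -> c and eps -> 0 the right side
   tends to p |c|^p, so no almost everywhere convergent subsequence is needed. *)
Require Import Defs.
From HB Require Import structures.
From mathcomp Require Import all_boot all_order all_algebra.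
From mathcomp Require Import all_classical all_reals all_analysis.
From mathcomp Require Import measurable_realfun.
From mathcomp Require Import ring lra.
Import Order.TTheory GRing.Theory Num.Theory.
Import numFieldNormedType.Exports.
Local Open Scope classical_set_scope.
Local Open Scope ring_scope.

(** * The concave majorant *)

(* The tangent at [m ^ 2] of the concave function [t `^ (p / 2)]; [psi] is the
   infimum of these tangents over [m >= eps]. *)
Definition tangent {R : realType} (p m t : R) : R :=
  p / 2 * m `^ (p - 2) * t + (1 - p / 2) * m `^ p.

Section Scalar.
Set Implicit Arguments. Unset Strict Implicit.
Context {R : realType} (p : R).
Hypotheses (p_gt0 : 0 < p) (p_lt1 : p < 1).
Implicit Types (a b c m eps eta t : R).

Lemma powR_sub2 m : 0 < m -> m `^ (p - 2) = m `^ p / m ^+ 2.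
Proof.
move=> m0; rewrite powRB ?(gt_eqF m0) ?implybT//.
by rewrite -(powR_mulrn 2 (ltW m0)).
Qed.

Lemma powR_sqr t q : 0 <= t -> (t ^+ 2) `^ (q / 2) = t `^ q.
Proof.
move=> t0; by rewrite -(powR_mulrn 2 t0) -powRrM mulrC divfK.
Qed.

(** Young's inequality with exponents [2 / p] and [2 / (2 - p)], applied to [y ^ p] and 1 for the
    ratio [y = |b| / m], then multiplied by [m ^ p]. *)
Lemma powR_le_tangent m b : 0 < m -> `|b| `^ p <= tangent p m (b ^+ 2).
Proof.
have p0 := p_gt0; have p1 := p_lt1.
move=> m0; set y := `|b| / m.
have y0 : 0 <= y by rewrite divr_ge0// ltW.
have by_ : `|b| = y * m by rewrite /y divfK// gt_eqF.
have young : y `^ p <= p / 2 * y ^+ 2 + (1 - p / 2).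
  have h := @conjugate_powR R (y `^ p) 1 (2 / p) (2 / (2 - p)).
  have q0 : 0 < 2 - p by lra.
  rewrite mulr1 powR1 -powRrM in h.
  move: h; rewrite (_ : p * (2 / p) = 2%:R); last by field; rewrite gt_eqF.
  rewrite powR_mulrn// (_ : p / 2 * y ^+ 2 + (1 - p / 2) =
    y ^+ 2 / (2 / p) + 1 / (2 / (2 - p))); last by field; rewrite !gt_eqF.
  move=> h.
  apply: h; rewrite ?powR_ge0 ?divr_gt0//.
  by field; rewrite !gt_eqF.
rewrite -(real_normK (num_real b)) by_ powRM ?(ltW m0)// /tangent powR_sub2//.
have -> : p / 2 * (m `^ p / m ^+ 2) * (y * m) ^+ 2 + (1 - p / 2) * m `^ p
   = (p / 2 * y ^+ 2 + (1 - p / 2)) * m `^ p by field; rewrite gt_eqF.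
by rewrite ler_wpM2r ?powR_ge0.
Qed.

Lemma powR_sub2_anti eps m : 0 < eps -> eps <= m -> m `^ (p - 2) <= eps `^ (p - 2).
Proof.
have p0 := p_gt0; have p1 := p_lt1.
move=> e0 em; have m0 := lt_le_trans e0 em.
rewrite -[p - 2]opprB !powRN lef_pV2 ?posrE ?powR_gt0//.
have q0 : 0 <= 2 - p by lra.
by rewrite ge0_ler_powR// nnegrE ltW.
Qed.

Lemma tangent_diag m : 0 < m -> tangent p m (m ^+ 2) = m `^ p.
Proof. by move=> m0; rewrite /tangent powR_sub2//; field; rewrite gt_eqF. Qed.

(** The linear branch of [psi] is the tangent at [eps ^ 2], and beyond it each point of the graph
    lies on its own tangent; the maximum merges both branches into one formula. *)
Lemma psi_sqrE eps a : 0 < eps ->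
  psi p eps (a ^+ 2) = tangent p (Num.max eps `|a|) (a ^+ 2).
Proof.
move=> e0; rewrite /psi -(real_normK (num_real a)) ltr_sqr ?nnegrE ?(ltW e0)//.
case: ltP => ea.
  rewrite /tangent -[p - 2]opprB powRN; field.
  by rewrite gt_eqF// powR_gt0.
have a0 := lt_le_trans e0 ea.
by rewrite powR_sqr// tangent_diag.
Qed.

Lemma dpsi_sqrE eps a : 0 < eps ->
  dpsi p eps (a ^+ 2) = p / 2 * (Num.max eps `|a|) `^ (p - 2).
Proof.
move=> e0; rewrite /dpsi -(real_normK (num_real a)) ltr_sqr ?nnegrE ?(ltW e0)//.
by case: ltP => // ea; rewrite powR_sqr.
Qed.

Lemma dpsi_ge0 eps t : 0 <= dpsi p eps t.
Proof. by rewrite /dpsi; case: ifP => _; rewrite mulr_ge0 ?powR_ge0// divr_ge0// ltW. Qed.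

Lemma dpsi_sqr_le eps a : 0 < eps -> dpsi p eps (a ^+ 2) <= p / 2 * eps `^ (p - 2).
Proof.
move=> e0; rewrite dpsi_sqrE// ler_wpM2l ?divr_ge0 ?(ltW p_gt0)//.
by rewrite powR_sub2_anti// le_max lexx.
Qed.

Lemma tangent_ge0 m t : 0 <= t -> 0 <= tangent p m t.
Proof.
have p0 := p_gt0; have p1 := p_lt1.
move=> t0; rewrite /tangent addr_ge0 ?mulr_ge0 ?powR_ge0 ?divr_ge0 ?(ltW p_gt0)//.
lra.
Qed.

Lemma psi_le_tangent eps m b : 0 < eps -> eps <= m ->
  psi p eps (b ^+ 2) <= tangent p m (b ^+ 2).
Proof.
have p0 := p_gt0; have p1 := p_lt1.
move=> e0 em; rewrite psi_sqrE//; have m0 := lt_le_trans e0 em.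
case: (leP eps `|b|) => eb.
  rewrite -[in tangent _ `|b| _](real_normK (num_real b)) tangent_diag ?powR_le_tangent//.
  exact: lt_le_trans eb.
(* Both sides are affine in [b ^ 2]; the slope at [m] is the smaller one, so
   the inequality follows from its instance at [b = eps]. *)
have := powR_le_tangent eps m0; rewrite gtr0_norm// -tangent_diag// /tangent => h.
have k := powR_sub2_anti e0 em.
have b2 : b ^+ 2 <= eps ^+ 2.
  by rewrite -(real_normK (num_real b)) ler_sqr ?nnegrE ?(ltW e0) ?(ltW eb).
have : 0 <= p / 2 * (eps `^ (p - 2) - m `^ (p - 2)) * (eps ^+ 2 - b ^+ 2).
  by rewrite !mulr_ge0 ?divr_ge0 ?(ltW p_gt0) ?subr_ge0.
lra.
Qed.

Lemma psi_ge0 eps b : 0 < eps -> 0 <= psi p eps (b ^+ 2).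
Proof. by move=> e0; rewrite psi_sqrE// tangent_ge0// sqr_ge0. Qed.

(** The right-hand side is the tangent at [max(eps, |a|)], which is one of those lying above
    [psi p eps]. *)
Lemma psi_concave eps a b : 0 < eps ->
  psi p eps (b ^+ 2) <=
  psi p eps (a ^+ 2) + dpsi p eps (a ^+ 2) * (b ^+ 2 - a ^+ 2).
Proof.
move=> e0; apply: le_trans (@psi_le_tangent _ (Num.max eps `|a|) b e0 _) _.
  by rewrite le_max lexx.
by rewrite psi_sqrE// dpsi_sqrE// /tangent le_eqVlt; apply/orP; left; apply/eqP; ring.
Qed.

(** Lowering [eps] enlarges the family of tangents whose minimum is taken. *)
Lemma psi_eps_mono eps eps' b : 0 < eps' -> eps' <= eps ->
  psi p eps' (b ^+ 2) <= psi p eps (b ^+ 2).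
Proof.
move=> e0 ee; rewrite (@psi_sqrE eps) ?(lt_le_trans e0 ee)//.
by rewrite psi_le_tangent// le_max ee.
Qed.

(** Each share [y = x / (a + b)] lies between 0 and 1, where [y <= y ^ p] because [p < 1]; the two
    shares add up to 1. *)
Lemma powRD_le a b : 0 <= a -> 0 <= b -> (a + b) `^ p <= a `^ p + b `^ p.
Proof.
move=> a0 b0; have [->|ab0] := eqVneq (a + b) 0.
  by rewrite powR0 ?gt_eqF// addr_ge0 ?powR_ge0.
have {}ab0 : 0 < a + b by rewrite lt_neqAle eq_sym ab0 addr_ge0.
have sub x : 0 <= x -> x <= a + b -> x / (a + b) * (a + b) `^ p <= x `^ p.
  rewrite le_eqVlt => /predU1P[<- _|x0 xab].
    by rewrite !mul0r powR_ge0.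
  have y0 : 0 < x / (a + b) by rewrite divr_gt0.
  rewrite -[in leRHS](divfK (lt0r_neq0 ab0) x) powRM ?(ltW y0) ?(ltW ab0)//.
  rewrite ler_wpM2r ?powR_ge0// ger1_powR ?(ltW p_lt1)//.
  by rewrite y0 ler_pdivrMr// mul1r.
have := lerD (sub a a0 _) (sub b b0 _).
rewrite -!mulrDl divff ?gt_eqF// mul1r.
by apply; rewrite ?lerDl ?lerDr.
Qed.

Lemma norm_powR_dist a c : `| `|a| `^ p - `|c| `^ p | <= `|a - c| `^ p.
Proof.
wlog ac : a c / `|c| <= `|a|.
  by move=> W; case: (leP `|c| `|a|) => [/W//|/ltW/W]; rewrite distrC (distrC c).
have mono := ge0_ler_powR (ltW p_gt0).
rewrite ger0_norm ?subr_ge0 ?mono ?nnegrE//.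
rewrite lerBlDr.
apply: le_trans (_ : (`|a - c| + `|c|) `^ p <= _); last exact: powRD_le.
by rewrite mono ?nnegrE ?addr_ge0// -{1}(subrK c a) ler_normD.
Qed.

(** The free parameter [eta] trades the constant against the quadratic term; after integration,
    smallness in L^2 yields smallness of the [p]-th power in L^1. *)
Lemma norm_powR_le eta t : 0 < eta -> `|t| `^ p <= eta `^ p + eta `^ (p - 2) * t ^+ 2.
Proof.
have p0 := p_gt0; have p1 := p_lt1.
move=> h0; apply: le_trans (powR_le_tangent t h0) _; rewrite /tangent.
have := powR_ge0 eta p.
have := mulr_ge0 (powR_ge0 eta (p - 2)) (sqr_ge0 t); nra.
Qed.

(** Replacing [|b| ^ p] and [|a| ^ p] by [|c| ^ p] costs the powers of the distances; what remains
    of [|c| ^ p] has the coefficient [2 - (2 - p) = p]. *)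
Lemma dpsi_mul_ge eps a b c : 0 < eps ->
  p * `|c| `^ p - 2 * `|b - c| `^ p - (2 - p) * `|a - c| `^ p - (2 - p) * eps `^ p
  <= 2 * (dpsi p eps (a ^+ 2) * b ^+ 2).
Proof.
have p0 := p_gt0; have p1 := p_lt1.
move=> e0; rewrite dpsi_sqrE//; set m := Num.max _ _.
have m0 : 0 < m by rewrite lt_max e0.
have mp : m `^ p <= eps `^ p + `|a| `^ p.
  by rewrite /m; case: (leP eps `|a|) => _; rewrite ?lerDr ?lerDl powR_ge0.
have := powR_le_tangent b m0; rewrite /tangent.
have := norm_powR_dist b c; have := norm_powR_dist a c.
rewrite !ler_norml => /andP[h1 h2] /andP[h3 h4].
move: h1 h2 h3 h4 mp.
set X := m `^ (p - 2); set A := `|a| `^ p; set B := `|b| `^ p; set C := `|c| `^ p.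
nra.
Qed.

End Scalar.

(** * Real sequences and Hilbert spaces *)

Section Forms.
Set Implicit Arguments. Unset Strict Implicit.
Context {R : realType}.

Lemma le0_small (x K : R) : (forall e, 0 < e -> x <= K * e) -> x <= 0.
Proof.
move=> h; rewrite leNgt; apply/negP => x0.
have K0 : 0 < `|K| + 1 by rewrite ltr_pwDr.
have := h (x / 2 / (`|K| + 1)); rewrite !divr_gt0// => /(_ isT) hx.
have : K * (x / 2 / (`|K| + 1)) <= x / 2.
  rewrite mulrCA ger_pMr ?divr_gt0// ler_pdivrMr// mul1r.
  by rewrite (le_trans (ler_norm K))// lerDl.
lra.
Qed.

Lemma nonincreasing_diff_cvg0 (E : nat -> R) (m : R) :
  (forall k, E k.+1 <= E k) -> (forall k, m <= E k) ->
  (E k - E k.+1) @[k --> \oo] --> 0.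
Proof.
move=> dec low.
have /cvg_ex[l El] : cvgn E.
  by apply: nonincreasing_is_cvgn; [exact/nonincreasing_seqP|exists m => _ [k _ <-]].
have ES : E k.+1 @[k --> \oo] --> l by have := El; rewrite -(cvg_shiftS E).
by rewrite -(subrr l); exact: cvgB El ES.
Qed.

Lemma cvg0_le (f g : nat -> R) : (forall n, `|f n| <= g n) ->
  g n @[n --> \oo] --> 0 -> f n @[n --> \oo] --> 0.
Proof.
move=> fg /cvgr0Pnorm_le g0; apply/cvgr0Pnorm_le => e /g0.
by apply: filterS => n; apply: le_trans; rewrite (le_trans (fg n))// ler_norm.
Qed.

Lemma powR_seq_cvg0 (p : R) (f : nat -> R) : 0 < p -> (forall n, 0 <= f n) ->
  f n @[n --> \oo] --> 0 -> (f n) `^ p @[n --> \oo] --> 0.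
Proof.
move=> p0 f0 /cvgr0Pnorm_le h; apply/cvgr0Pnorm_le => e e0.
have /h : 0 < e `^ p^-1 by rewrite powR_gt0.
apply: filterS => n; rewrite !ger0_norm ?powR_ge0// => fe.
have -> : e = (e `^ p^-1) `^ p by rewrite -powRrM mulVf ?gt_eqF// powRr1// ltW.
by rewrite ge0_ler_powR ?nnegrE ?powR_ge0// ltW.
Qed.

(** For [D > 0] the vertex [t = - B / D] decides. For [D = 0] the expression is affine in [t], and a
    nonzero slope would let it take the value -1. The degenerate case is included because the forms
    treated below may be merely nonnegative. *)
Lemma quad_ge0_discr (A B D : R) : 0 <= D ->
  (forall t, 0 <= A + 2 * t * B + t ^+ 2 * D) -> B ^+ 2 <= A * D.
Proof.
move=> D0 h; have A0 : 0 <= A by have := h 0; rewrite expr0n/=; lra.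
move: D0; rewrite le_eqVlt => /predU1P[D0|D0].
  have [->|B0] := eqVneq B 0; first by rewrite expr0n -D0 mulr0.
  have := h (- (A + 1) / (2 * B)); rewrite -D0 mulr0 addr0.
  have -> : A + 2 * (- (A + 1) / (2 * B)) * B = -1 by field.
  by rewrite ler0N1.
have := h (- B / D).
have -> : A + 2 * (- B / D) * B + (- B / D) ^+ 2 * D = (A * D - B ^+ 2) / D.
  by field; rewrite gt_eqF.
by rewrite pmulr_lge0 ?invr_gt0// subr_ge0.
Qed.

Definition sym_bilinear {V : lmodType R} (a : V -> V -> R) : Prop :=
  (forall u v, a u v = a v u) /\
  (forall c u w v, a (c *: u + w) v = c * a u v + a w v).

Lemma form_linear (V : lmodType R) (a : V -> V -> R) : sym_bilinear a ->
  forall c u w v, a v (c *: u + w) = c * a v u + a v w.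
Proof. by move=> [s l] c u w v; rewrite s l !(s v). Qed.

Section LinearForm.
Context {V : lmodType R} {l : V -> R}.
Hypothesis l_lin : forall c u w, l (c *: u + w) = c * l u + l w.

Lemma linfD u w : l (u + w) = l u + l w.
Proof. by rewrite -[u]scale1r l_lin mul1r scale1r. Qed.

Lemma linf0 : l 0 = 0.
Proof. by have /esym/eqP := linfD 0 0; rewrite addr0 -subr_eq0 addrK => /eqP. Qed.

Lemma linfZ c u : l (c *: u) = c * l u.
Proof. by rewrite -[c *: u]addr0 l_lin linf0 addr0. Qed.

Lemma linfB u w : l (u - w) = l u - l w.
Proof. by rewrite linfD -scaleN1r linfZ mulN1r. Qed.

End LinearForm.

Section Form.
Context {V : lmodType R} {a : V -> V -> R}.
Hypothesis sa : sym_bilinear a.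

Lemma formC u v : a u v = a v u. Proof. exact: (proj1 sa). Qed.

Lemma formDl u w v : a (u + w) v = a u v + a w v.
Proof. by apply: (linfD (l := a^~ v)) => *; exact: (proj2 sa). Qed.

Lemma formBl u w v : a (u - w) v = a u v - a w v.
Proof. by apply: (linfB (l := a^~ v)) => *; exact: (proj2 sa). Qed.

Lemma formZl c u v : a (c *: u) v = c * a u v.
Proof. by apply: (linfZ (l := a^~ v)) => *; exact: (proj2 sa). Qed.

Lemma formDr v u w : a v (u + w) = a v u + a v w.
Proof. by rewrite formC formDl !(formC v). Qed.

Lemma formBr v u w : a v (u - w) = a v u - a v w.
Proof. by rewrite formC formBl !(formC v). Qed.

Lemma formZr c u v : a v (c *: u) = c * a v u.
Proof. by rewrite formC formZl (formC v). Qed.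

Lemma form_addZ u t v : a (u + t *: v) (u + t *: v) =
  a u u + 2 * t * a u v + t ^+ 2 * a v v.
Proof.
rewrite formDl !formDr !formZl !formZr (formC v u); ring.
Qed.

Lemma form_cauchy_schwarz u v : (forall w, 0 <= a w w) ->
  a u v ^+ 2 <= a u u * a v v.
Proof.
by move=> a0; apply: quad_ge0_discr => // t; rewrite -form_addZ a0.
Qed.

End Form.

(* The minimizing sequences of [a v v - 2 * l v] are Cauchy by the
   parallelogram identity. *)
Lemma sym_lax_milgram (V : completeNormedModType R) (a : V -> V -> R)
    (l : V -> R) (c C : R) :
  sym_bilinear a -> 0 < c -> (forall v, c * `|v| ^+ 2 <= a v v) ->
  0 <= C -> (forall v, a v v <= C * `|v| ^+ 2) -> is_dual l ->
  exists z, forall v, a z v = l v.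
Proof.
move=> sa c0 ca C0 aC [llin [M lM]].
have a0 v : 0 <= a v v by apply: le_trans (ca v); rewrite mulr_ge0// ltW.
pose J v := a v v - 2 * l v; pose I := inf (range J).
have infJ : has_inf (range J).
  split; first by exists (J 0), 0.
  (* By coercivity [J v] is at least [c x^2 - 2 M x] with [x] the norm of [v]; the bound is the
     minimum of this parabola. *)
  exists (- (M ^+ 2 / c)) => _ [v _ <-]; rewrite /J.
  have h1 := ca v; have /(le_trans (ler_norm _)) h2 := lM v.
  have h3 : 0 <= c * (`|v| - M / c) ^+ 2 by rewrite mulr_ge0 ?sqr_ge0 ?ltW.
  have e3 : c * (`|v| - M / c) ^+ 2 = c * `|v| ^+ 2 - 2 * M * `|v| + M ^+ 2 / c.
    by field; rewrite gt_eqF.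
  rewrite e3 in h3; move: h1 h2 h3; clear => *; lra.
have IJ v : I <= J v by apply: ge_inf; [exact: infJ.2|exists v].
have [w Jw] : exists w : nat -> V, forall n, J (w n) < I + n.+1%:R^-1.
  suff /choice[w Jw] : forall n : nat, exists v, J v < I + n.+1%:R^-1 by exists w.
  move=> n; have n0 : 0 < n.+1%:R^-1 :> R by rewrite invr_gt0.
  by have [_ [v _ <-] Jv] := inf_adherent n0 infJ; exists v.
have par x y : a (x - y) (x - y) <= 2 * (J x + J y) - 4 * I.
  have := IJ (2^-1 *: (x + y)); rewrite /J.
  rewrite (formZl sa) (formZr sa) (linfZ llin) (linfD llin) (formBl sa) !(formBr sa).
  rewrite (formDl sa) !(formDr sa) (formC sa y x).
  move: (I) (a x x) (a x y) (a y y) (l x) (l y); clear => *; lra.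
have cauchy_w : cauchy (w @ \oo).
  apply: cauchy_exP => e e0.
  (* Two points whose values exceed [I] by less than [d] satisfy [a (x - y) (x - y) < 4 d] by [par],
     whence the factor 1/4. *)
  have d0 : 0 < c * e ^+ 2 / 4 by rewrite divr_gt0// mulr_gt0// exprn_gt0.
  have /= [N _ hN] := near_infty_natSinv_lt (PosNum d0).
  exists (w N), N => // n /= Nn; rewrite -ball_normE /ball_/=.
  rewrite -(@ltr_pXn2r _ 2) ?nnegrE ?(ltW e0)//.
  rewrite -(ltr_pM2l c0) (le_lt_trans (ca _))// (le_lt_trans (par _ _))//.
  have /= k1 := hN _ (leqnn N); have /= k2 := hN _ Nn.
  have k3 : J (w N) < I + c * e ^+ 2 / 4 by rewrite (lt_trans (Jw N))// ltrD2l.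
  have k4 : J (w n) < I + c * e ^+ 2 / 4 by rewrite (lt_trans (Jw n))// ltrD2l.
  move: k3 k4; move: (I) (J _) (J _); clear => *; lra.
have /cvg_ex[z wz] : cvg (w @ \oo) by exact: cauchy_cvg.
exists z => v.
suff : (a z v - l v) ^+ 2 <= 0.
  move=> h; apply/eqP; rewrite -subr_eq0 -sqrf_eq0 eq_le h/= sqr_ge0//.
(* The error is split as a sum [x + y] with squares bounded by [e * a v v] and [C * e * a v v]; then
   [(x + y)^2 <= 2 x^2 + 2 y^2]. *)
apply: (@le0_small _ (2 * a v v * (1 + C))) => e e0.
have s0 : 0 < Num.sqrt e by rewrite sqrtr_gt0.
have /= [N1 _ h1] := near_infty_natSinv_lt (PosNum e0).
have /cvgrPdist_lt /(_ _ s0) [N2 _ h2] := wz.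
pose n := maxn N1 N2.
have Jn : J (w n) <= I + e.
  by rewrite (le_trans (ltW (Jw n)))// lerD2l ltW// h1//= leq_maxl.
have wzn : `|z - w n| ^+ 2 <= e.
  rewrite -[leRHS]sqr_sqrtr ?(ltW e0)// ler_sqr ?nnegrE ?sqrtr_ge0//.
  by rewrite ltW// h2//= leq_maxr.
(* An approximate Euler equation: [J] at [w n + t v] is at least [J (w n) - e] for every [t], and
   the discriminant of this quadratic in [t] bounds its linear coefficient. *)
have E1 : (a (w n) v - l v) ^+ 2 <= e * a v v.
  apply: quad_ge0_discr => // t.
  have := IJ (w n + t *: v); rewrite /J (form_addZ sa) (linfD llin) (linfZ llin).
  move: Jn; rewrite /J; move: (I) (a _ _) (a _ _) (a _ _) (l _) (l _); clear => *; lra.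
have E2 : (a (z - w n) v) ^+ 2 <= (C * e) * a v v.
  apply: le_trans (form_cauchy_schwarz sa _ _ a0) _.
  by rewrite ler_wpM2r// (le_trans (aC _))// ler_wpM2l.
have -> : a z v - l v = (a (w n) v - l v) + a (z - w n) v.
  by rewrite (formBl sa); ring.
have := sqr_ge0 ((a (w n) v - l v) - a (z - w n) v).
move: E1 E2; move: (a _ _) (a _ _) (a _ _) (l _); clear => *; lra.
Qed.

Lemma hilbert_form (V : completeNormedModType R) (ip : V -> V -> R) :
  is_hilbert_ip ip -> sym_bilinear ip.
Proof. by case. Qed.

Lemma riesz (V : completeNormedModType R) (ip : V -> V -> R) (l : V -> R) :
  is_hilbert_ip ip -> is_dual l -> exists z, forall v, ip z v = l v.
Proof.
move=> /[dup] hip [_ _ ipn]; apply: (@sym_lax_milgram V ip l 1 1) => //.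
- exact: hilbert_form.
- by move=> v; rewrite ipn mul1r.
- by move=> v; rewrite ipn mul1r.
Qed.

(** Weak convergence is tested only against inner products; the Riesz representative transfers it to
    an arbitrary functional. *)
Lemma weak_cvg_dual (V : completeNormedModType R) (ip : V -> V -> R) (l : V -> R)
    (u : nat -> V) (ubar : V) : is_hilbert_ip ip -> is_dual l ->
  weak_cvg ip u ubar -> l (u n) @[n --> \oo] --> l ubar.
Proof.
move=> hip /(riesz hip)[z zl] /(_ z).
have E v : ip v z = l v by rewrite (formC (hilbert_form hip)) zl.
by rewrite E; under eq_fun do rewrite E.
Qed.

Lemma ip_norm_le (V : completeNormedModType R) (ip : V -> V -> R) u v :
  is_hilbert_ip ip -> `|ip u v| <= `|u| * `|v|.
Proof.
move=> hip; have [_ _ ipn] := hip.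
have sa := hilbert_form hip.
rewrite -(@ler_pXn2r _ 2) ?nnegrE ?mulr_ge0// real_normK ?num_real//.
by rewrite exprMn -!ipn form_cauchy_schwarz// => w; rewrite ipn sqr_ge0.
Qed.

End Forms.

(** * The descent inequality from a Lipschitz derivative *)

Section MeanValue.
Set Implicit Arguments. Unset Strict Implicit.
Context {R : realType} {V : completeNormedModType R}.
Context {F : V -> R} {F' : V -> V -> R}.
Hypothesis dF : cont_frechet F F'.

Lemma is_derive_line u h (t : R) :
  is_derive t 1 (fun s : R => F (u + s *: h)) (F' (u + t *: h) h).
Proof.
have [lin dF' _] := dF.
suff H : (fun s : R => s^-1 *: (F (u + (s *: 1 + t) *: h) - F (u + t *: h)))
    @ 0^' --> F' (u + t *: h) h.
  by split; [apply/cvg_ex; exists (F' (u + t *: h) h) | exact: cvg_lim].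
apply/cvgrPdist_le => e e0.
(* Adding 1 keeps the divisor positive when [h = 0]. *)
have h0 : 0 < `|h| + 1 by rewrite ltr_pwDr.
have [d [d0 hd]] := dF' (u + t *: h) (e / (`|h| + 1)) (divr_gt0 e0 h0).
near=> s.
rewrite [s *: 1]mulr1.
have s0 : s != 0 by near: s; exact: nbhs_dnbhs_neq.
have sd : `|s *: h| < d.
  rewrite normrZ (@le_lt_trans _ _ (`|s| * (`|h| + 1)))//.
    by rewrite ler_wpM2l// lerDl.
  rewrite -ltr_pdivlMr//; near: s; apply: dnbhs0_lt; exact: divr_gt0.
have := hd _ sd; rewrite -(addrA u) -scalerDl [t + s]addrC normrZ.
have [Fl _] := lin (u + t *: h).
rewrite (linfZ Fl) distrC => H.
set G := F _ - F _ in H *.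
have -> : F' (u + t *: h) h - s^-1 *: G = - s^-1 * (G - s * F' (u + t *: h) h).
  by rewrite /GRing.scale/=; field.
rewrite normrM normrN normfV mulrC ler_pdivrMr ?normr_gt0// distrC.
apply: le_trans H _.
rewrite (mulrC `|s|) mulrA ler_wpM2r// mulrAC ler_pdivrMr// ler_wpM2l ?(ltW e0)//.
by rewrite lerDl.
Unshelve. all: by end_near. Qed.

(** By the mean value theorem [F w - F u] is the derivative at some intermediate point of the
    segment, which stays in the ball by convexity. The resulting constant [C], not [C / 2], is the
    form in which [condD] asks for it. *)
Lemma descent (M C : R) u w : 0 <= C ->
  (forall x y, `|x| <= M -> `|y| <= M ->
     forall v, `|F' x v - F' y v| <= C * `|x - y| * `|v|) ->
  `|u| <= M -> `|w| <= M -> F w <= F u + F' u (w - u) + C * `|w - u| ^+ 2.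
Proof.
move=> C0 lip uM wM; set h := w - u.
have [||t] := @MVT R (fun s : R => F (u + s *: h)) (fun s => F' (u + s *: h) h) 0 1 ltr01.
- by move=> t _; exact: is_derive_line.
- apply: derivable_within_continuous => t _.
  by have [] := is_derive_line u h t.
rewrite in_itv/= => /andP[t0 t1].
rewrite scale1r scale0r addr0 subr0 mulr1 [u + h]addrC {1}/h subrK => E.
have tM : `|u + t *: h| <= M.
  have -> : u + t *: h = (1 - t) *: u + t *: w.
    by rewrite /h scalerBr scalerBl scale1r addrAC addrA.
  rewrite (le_trans (ler_normD _ _))// !normrZ (gtr0_norm t0) gtr0_norm ?subr_gt0//.
  nra.
have := lip _ _ tM uM h; rewrite addrAC subrr add0r normrZ (gtr0_norm t0).
move=> /(le_trans (ler_norm _)) H.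
have : 0 <= C * (1 - t) * `|h| ^+ 2.
  by rewrite !mulr_ge0 ?sqr_ge0// subr_ge0 ltW.
lra.
Qed.

End MeanValue.

(** * Integrals *)

Section Integrals.
Set Implicit Arguments. Unset Strict Implicit.
Context {R : realType} {d : measure_display} {T : measurableType d}.
Context {mu : {measure set T -> \bar R}}.
Implicit Types (f g rho : T -> R).

Local Notation intble f := (mu.-integrable setT (EFin \o f)).

Lemma intbleD f g : intble f -> intble g -> intble (fun x => f x + g x).
Proof. by move=> hf hg; have := integrableD measurableT hf hg. Qed.

Lemma intbleZ k f : intble f -> intble (fun x => k * f x).
Proof. by move=> hf; have := integrableZl measurableT k hf. Qed.

Lemma intbleB f g : intble f -> intble g -> intble (fun x => f x - g x).
Proof.
move=> hf /(intbleZ (-1)) /(intbleD hf).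
by under eq_fun do rewrite mulN1r.
Qed.

Lemma intble_le f g : measurable_fun setT f -> (forall x, `|f x| <= g x) ->
  intble g -> intble f.
Proof.
move=> mf fg ig.
apply: (@le_integrable _ _ _ mu _ measurableT _ (EFin \o g)) => //.
  exact/measurable_EFinP.
by move=> x _; rewrite /= lee_fin (le_trans (fg x))// ler_norm.
Qed.

Lemma is_L2_mul f g rho c : is_L2 mu f -> is_L2 mu g -> measurable_fun setT rho ->
  (forall x, `|rho x| <= c) -> intble (fun x => rho x * (f x * g x)).
Proof.
move=> [mf f2] [mg g2] mrho rhoc.
apply: (intble_le (g := fun x => c * (f x ^+ 2 + g x ^+ 2))).
- by apply: measurable_funM => //; exact: measurable_funM.
- move=> x; rewrite normrM ler_pM// normrM.
  rewrite -(real_normK (num_real (f x))) -(real_normK (num_real (g x))).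
  have := sqr_ge0 (`|f x| - `|g x|); have := sqr_ge0 (`|f x| + `|g x|); lra.
- by apply: intbleZ; exact: intbleD.
Qed.

Context (p : R).
Hypotheses (p_gt0 : 0 < p) (p_lt1 : p < 1).

Lemma measurable_dpsi eps f : measurable_fun setT f ->
  measurable_fun setT (fun x => dpsi p eps (f x ^+ 2)).
Proof.
move=> mf; have mf2 := measurable_funX 2 mf.
rewrite /dpsi; apply: measurable_fun_ifT => //.
- exact: measurable_fun_ltr.
- apply: measurable_funM => //.
  exact: (measurableT_comp (measurable_powR _) mf2).
Qed.

Lemma measurable_psi eps f : measurable_fun setT f ->
  measurable_fun setT (fun x => psi p eps (f x ^+ 2)).
Proof.
move=> mf; have mf2 := measurable_funX 2 mf.
rewrite /psi; apply: measurable_fun_ifT => //.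
- exact: measurable_fun_ltr.
- apply: measurable_funD => //; apply: measurable_funM => //.
  exact: measurable_funM.
- exact: (measurableT_comp (measurable_powR _) mf2).
Qed.

Hypothesis mu_fin : (mu setT < +oo)%E.

Lemma intble_cst k : intble (fun=> k).
Proof.
apply/integrableP; split; first exact/measurable_EFinP.
by rewrite /= integral_cst// lte_mul_pinfty.
Qed.

Lemma is_L2_psi eps f : 0 < eps -> is_L2 mu f ->
  intble (fun x => psi p eps (f x ^+ 2)).
Proof.
move=> e0 [mf f2].
apply: (intble_le (g := fun x => tangent p eps (f x ^+ 2))).
- exact: measurable_psi.
- by move=> x; rewrite ger0_norm ?psi_ge0 ?psi_le_tangent.
- by apply: intbleD; [exact: intbleZ|exact: intble_cst].
Qed.

Lemma is_L2_powR f : is_L2 mu f -> intble (fun x => `|f x| `^ p).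
Proof.
move=> [mf f2]; apply: (intble_le (g := fun x => tangent p 1 (f x ^+ 2))).
- apply: (measurableT_comp (measurable_powR _)).
  exact: measurableT_comp.
- by move=> x; rewrite ger0_norm ?powR_ge0 ?powR_le_tangent.
- by apply: intbleD; [exact: intbleZ|exact: intble_cst].
Qed.

Lemma Rintegral_powR_le eta f : 0 < eta -> is_L2 mu f ->
  Rintegral mu setT (fun x => `|f x| `^ p) <=
  eta `^ p * fine (mu setT) + eta `^ (p - 2) * L2sq mu f.
Proof.
move=> eta0 f2; have [mf if2] := f2; rewrite /L2sq.
rewrite -Rintegral_cst// -RintegralZl// -RintegralD//; first last.
- exact: intbleZ.
- exact: intble_cst.
apply: le_Rintegral => //; first exact: is_L2_powR.
- by apply: intbleD; [exact: intble_cst|exact: intbleZ].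
- by move=> x _; exact: norm_powR_le.
Qed.

End Integrals.

(** * The embedding and the subproblem *)

Section Subproblem.
Set Implicit Arguments. Unset Strict Implicit.
Context {R : realType} {d : measure_display} {T : measurableType d}.
Context {mu : {measure set T -> \bar R}} {V : completeNormedModType R}.
Context {iota : V -> T -> R} {ip : V -> V -> R}.
Hypotheses (hip : is_hilbert_ip ip) (hemb : compact_dense_embedding mu iota).

Implicit Types (rho : T -> R) (v w z : V) (c eps L : R).

(** Weight 1 gives the L^2 inner product and weight [dpsi] the linearized penalty, so one set of
    lemmas serves both. *)
Definition wform (rho : T -> R) (u v : V) : R :=
  Rintegral mu setT (fun x => rho x * (iota u x * iota v x)).

Lemma emb_L2 v : is_L2 mu (iota v). Proof. exact: (proj1 hemb). Qed.

Lemma embB (u v : V) x : iota (u - v) x = iota u x - iota v x.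
Proof.
have [_ [lin _ _ _ _]] := hemb.
by apply: (@linfB R V (iota^~ x)) => c a b; exact: lin.
Qed.

Lemma wform_int rho c (u v : V) : measurable_fun setT rho -> (forall x, `|rho x| <= c) ->
  mu.-integrable setT (EFin \o (fun x => rho x * (iota u x * iota v x))).
Proof. by move=> mrho rhoc; exact: is_L2_mul (emb_L2 u) (emb_L2 v) mrho rhoc. Qed.

Lemma wform_bilinear rho c : measurable_fun setT rho -> (forall x, `|rho x| <= c) ->
  sym_bilinear (wform rho).
Proof.
move=> mrho rhoc; have [_ [lin _ _ _ _]] := hemb.
split=> [u v|k u w v]; rewrite /wform.
  by apply: eq_Rintegral => x _; rewrite (mulrC (iota u x)).
have intb := wform_int _ _ mrho rhoc.
rewrite -RintegralZl// -RintegralD//; last exact: intbleZ.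
by apply: eq_Rintegral => x _; rewrite lin; ring.
Qed.

Lemma wform_ge0 rho v : (forall x, 0 <= rho x) -> 0 <= wform rho v v.
Proof. by move=> h; apply: Rintegral_ge0 => x _; rewrite mulr_ge0// -expr2 sqr_ge0. Qed.

Lemma L2sq_wform v : L2sq mu (iota v) = wform (fun=> 1) v v.
Proof. by apply: eq_Rintegral => x _; rewrite mul1r expr2. Qed.

Lemma L2sqD_le v w :
  L2sq mu (iota (v + w)) <= 2 * L2sq mu (iota v) + 2 * L2sq mu (iota w).
Proof.
have m1 : measurable_fun setT (fun _ : T => 1 : R) by [].
have r1 (x : T) : `|(1 : R)| <= 1 by rewrite normr1.
have sa := wform_bilinear m1 r1.
have := @wform_ge0 (fun=> 1) (v - w) (fun=> ler01).
rewrite !L2sq_wform (formBl sa) !(formBr sa) (formDl sa) !(formDr sa).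
rewrite (formC sa w v).
clear r1 m1; move: (wform _ v v) (wform _ v w) (wform _ w w) => x y z; lra.
Qed.

Lemma wform_le rho c : measurable_fun setT rho -> (forall x, 0 <= rho x <= c) ->
  exists2 C, 0 <= C & forall v, wform rho v v <= C * `|v| ^+ 2.
Proof.
move=> mrho rhoc; have [_ [_ _ [C hC] _ _]] := hemb.
have rhoc' x : `|rho x| <= c by have /andP[r0 rc] := rhoc x; rewrite ger0_norm.
exists (`|c| * `|C|); first by rewrite mulr_ge0.
move=> v; rewrite -mulrA.
apply: (@le_trans _ _ (`|c| * L2sq mu (iota v))); last first.
  rewrite ler_wpM2l// (le_trans (hC v))// ler_wpM2r ?sqr_ge0//.
  exact: ler_norm.
have [_ i2] := emb_L2 v.
rewrite /L2sq -RintegralZl//; apply: le_Rintegral => //.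
- exact: wform_int rhoc'.
- exact: intbleZ.
- move=> x _; rewrite -expr2 ler_wpM2r ?sqr_ge0//.
  by rewrite (le_trans _ (ler_norm c))//; case/andP: (rhoc x).
Qed.

Lemma wform_dual rho c (u : V) : measurable_fun setT rho -> (forall x, 0 <= rho x <= c) ->
  is_dual (wform rho u).
Proof.
move=> mrho rhoc.
have rhoc' x : `|rho x| <= c by have /andP[r0 rc] := rhoc x; rewrite ger0_norm.
have sa := wform_bilinear mrho rhoc'.
have a0 v : 0 <= wform rho v v by apply: wform_ge0 => x; case/andP: (rhoc x).
have [C C0 hC] := wform_le mrho rhoc.
split; first by move=> k v w; rewrite form_linear.
exists (Num.sqrt (wform rho u u * C)) => v.
rewrite -(@ler_pXn2r _ 2) ?nnegrE ?mulr_ge0 ?sqrtr_ge0// real_normK ?num_real//.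
rewrite exprMn sqr_sqrtr ?mulr_ge0// (le_trans (form_cauchy_schwarz sa u v a0))//.
by rewrite -mulrA ler_wpM2l.
Qed.

Lemma cvg_increasing (chi : nat -> nat) : (forall n, (chi n < chi n.+1)%N) ->
  chi n @[n --> \oo] --> \oo.
Proof.
move=> hchi A [N _ NA].
have le_chi n : (n <= chi n)%N by elim: n => // n /leq_ltn_trans; apply.
by exists N => // n /= Nn; apply: NA; rewrite /= (leq_trans Nn).
Qed.

Lemma weak_cvg_sub (u : nat -> V) ubar (chi : nat -> nat) :
  (forall n, (chi n < chi n.+1)%N) -> weak_cvg ip u ubar ->
  weak_cvg ip (u \o chi) ubar.
Proof. by move=> hchi uw v; exact: (cvg_comp _ _ (cvg_increasing hchi) (uw v)). Qed.

(** Compactness only gives a Cauchy subsequence. To identify its limit, put [y n = u (chi n) - ubar]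
    and expand the square of [y m - y n]: for fixed [m] the mixed term vanishes as [n] grows, by
    weak convergence, so the L^2 norm of [y m] is controlled by the Cauchy bound. *)
Lemma compact_weak_cvg (u : nat -> V) ubar :
  weak_cvg ip u ubar -> (exists M, forall n, `|u n| <= M) ->
  exists2 chi : nat -> nat, (forall n, (chi n < chi n.+1)%N) &
    L2sq mu (iota (u (chi n) - ubar)) @[n --> \oo] --> 0.
Proof.
move=> uw ubd; have [_ [_ _ _ compact _]] := hemb.
have [chi [hchi cau]] := compact u ubd; exists chi => //.
have m1 : measurable_fun setT (fun _ : T => 1 : R) by [].
have r1 (x : T) : 0 <= (1 : R) <= 1 by rewrite ler01 lexx.
have r1' (x : T) : `|(1 : R)| <= 1 by rewrite normr1.
have sa := wform_bilinear m1 r1'.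
have a0 v : 0 <= wform (fun=> 1) v v by apply: wform_ge0 => x; exact: ler01.
apply/cvgr0Pnorm_le => e e0.
have e20 : 0 < e / 2 by rewrite divr_gt0.
have [N hN] := cau _ e20.
exists N => // m /= Nm.
rewrite L2sq_wform ger0_norm; last exact: a0.
set a := wform _ in sa a0 *.
pose y n := u (chi n) - ubar.
have yC n : (N <= n)%N -> a (y m - y n) (y m - y n) < e / 2.
  move=> Nn; rewrite /y opprB addrA subrK /a -L2sq_wform.
  rewrite (_ : iota _ = fun x => iota (u (chi m)) x - iota (u (chi n)) x).
    exact: hN.
  by apply/funext => x; exact: embB.
have := weak_cvg_dual hip (wform_dual (y m) m1 r1) (weak_cvg_sub hchi uw).
have e40 : 0 < e / 4 by rewrite divr_gt0.
move=> /cvgrPdist_le/(_ _ e40)[N' _ hN'].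
pose n := maxn N N'.
have := hN' n (leq_maxr _ _); rewrite distrC /= -/a -(formBr sa) -/(y n).
move=> /(le_trans (ler_norm _)).
have := yC n (leq_maxl _ _); have := a0 (y n).
rewrite -/(y m); move: (y n) (y m) => Y Z.
rewrite (formBl sa) !(formBr sa) (formC sa Y Z).
move: (a _ _) (a _ _) (a _ _); clear => *; lra.
Qed.

(** Completing the square at the solution [z] of the linear equation; existence and uniqueness of
    the minimizer both rest on this. *)
Lemma quad_gap (a : V -> V -> R) (l : V -> R) z w : sym_bilinear a ->
  (forall v, a z v = l v) ->
  a w w - 2 * l w - (a z z - 2 * l z) = a (w - z) (w - z).
Proof.
move=> sa az; rewrite -!az (formBl sa) !(formBr sa) (formC sa w z); ring.
Qed.

(** * The subproblem as a coercive linear equation *)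

Context {F : V -> R} {F' : V -> V -> R} {alpha beta p : R}.
Hypotheses (mu_fin : (mu setT < +oo)%E) (dF : cont_frechet F F').
Hypotheses (alpha_gt0 : 0 < alpha) (beta_gt0 : 0 < beta).
Hypotheses (p_gt0 : 0 < p) (p_lt1 : p < 1).

Definition weight (eps : R) (uk : V) (x : T) : R := dpsi p eps (iota uk x ^+ 2).

Definition Psi (eps : R) (v : V) : R :=
  Rintegral mu setT (fun x => psi p eps (iota v x ^+ 2)).

Definition energy (eps : R) (v : V) : R :=
  F v + alpha / 2 * `|v| ^+ 2 + beta * Psi eps v.

(** Left-hand side of the optimality condition [qform L eps uk w v = qlin L uk v]; the factor 2
    before [beta] comes from differentiating the square in the penalty. *)
Definition qform (L eps : R) (uk u v : V) : R :=
  (L + alpha) * ip u v + 2 * beta * wform (weight eps uk) u v.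

Definition qlin (L : R) (uk v : V) : R := L * ip uk v - F' uk v.

Local Notation Qmin eps uk L := (is_Qmin mu iota F F' alpha beta p eps uk L).

Lemma weight_measurable eps uk : measurable_fun setT (weight eps uk).
Proof. exact: measurable_dpsi (emb_L2 uk).1. Qed.

Lemma weight_ge0 eps uk x : 0 <= weight eps uk x.
Proof. exact: dpsi_ge0. Qed.

Lemma weight_bound eps uk : 0 < eps ->
  forall x, 0 <= weight eps uk x <= p / 2 * eps `^ (p - 2).
Proof. by move=> e0 x; rewrite weight_ge0 dpsi_sqr_le. Qed.

Lemma weight_norm eps uk : 0 < eps ->
  forall x, `|weight eps uk x| <= p / 2 * eps `^ (p - 2).
Proof. by move=> e0 x; rewrite ger0_norm ?weight_ge0// dpsi_sqr_le. Qed.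

Lemma weight_int eps (uk u v : V) : 0 < eps ->
  mu.-integrable setT (EFin \o (fun x => weight eps uk x * (iota u x * iota v x))).
Proof. by move=> /(weight_norm uk); apply: wform_int; exact: weight_measurable. Qed.

Lemma Psi_int eps v : 0 < eps ->
  mu.-integrable setT (EFin \o (fun x => psi p eps (iota v x ^+ 2))).
Proof. by move=> e0; apply: is_L2_psi => //; exact: emb_L2. Qed.

Lemma weight_form_linear eps uk : 0 < eps -> sym_bilinear (wform (weight eps uk)).
Proof.
by move=> e0; exact: wform_bilinear (weight_measurable _ _) (weight_norm uk e0).
Qed.

Lemma linearized_integral eps (uk u : V) : 0 < eps ->
  mu.-integrable setT (EFin \o (fun x => psi p eps (iota uk x ^+ 2) +
     weight eps uk x * (iota u x ^+ 2 - iota uk x ^+ 2))) /\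
  Rintegral mu setT (fun x => psi p eps (iota uk x ^+ 2) +
     weight eps uk x * (iota u x ^+ 2 - iota uk x ^+ 2)) =
  Psi eps uk + (wform (weight eps uk) u u - wform (weight eps uk) uk uk).
Proof.
move=> e0; have iP := Psi_int uk e0.
have iu := weight_int uk u u e0; have ik := weight_int uk uk uk e0.
have E : (fun x => psi p eps (iota uk x ^+ 2) +
     weight eps uk x * (iota u x ^+ 2 - iota uk x ^+ 2)) =
   (fun x => psi p eps (iota uk x ^+ 2) + (weight eps uk x * (iota u x * iota u x) -
      weight eps uk x * (iota uk x * iota uk x))).
  by apply/funext => x; rewrite -!expr2 mulrBr.
have iB := intbleB iu ik.
rewrite E; split; first exact: intbleD.
by rewrite /Psi /wform -RintegralB// -RintegralD.
Qed.

Lemma Psi_concave eps uk w : 0 < eps ->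
  Psi eps w <= Psi eps uk + (wform (weight eps uk) w w - wform (weight eps uk) uk uk).
Proof.
move=> e0; have [iL <-] := linearized_integral uk w e0.
by apply: le_Rintegral => //; [exact: Psi_int|move=> x _; exact: psi_concave].
Qed.

Lemma Psi_mono eps eps' v : 0 < eps' -> eps' <= eps -> Psi eps' v <= Psi eps v.
Proof.
move=> e0 ee; have e1 := lt_le_trans e0 ee.
by apply: le_Rintegral => //; [exact: Psi_int|exact: Psi_int|
  move=> x _; exact: psi_eps_mono].
Qed.

Lemma Psi_ge0 eps v : 0 < eps -> 0 <= Psi eps v.
Proof. by move=> e0; apply: Rintegral_ge0 => x _; exact: psi_ge0. Qed.

Lemma qform_bilinear L eps uk : 0 < eps -> sym_bilinear (qform L eps uk).
Proof.
move=> e0; have [sw lw] := weight_form_linear uk e0; have [si li _] := hip.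
split=> [u v|c u w v]; rewrite /qform ?li ?lw; first by rewrite si sw.
ring.
Qed.

Lemma qform_coercive L eps uk v : 0 <= L -> alpha * `|v| ^+ 2 <= qform L eps uk v v.
Proof.
move=> L0; have [_ _ ipn] := hip; rewrite /qform ipn.
have a0 : 0 <= 2 * beta * wform (weight eps uk) v v.
  rewrite !mulr_ge0 ?(ltW beta_gt0)//.
  by apply: wform_ge0 => x; exact: weight_ge0.
have : 0 <= L * `|v| ^+ 2 by rewrite mulr_ge0 ?sqr_ge0.
lra.
Qed.

Lemma Qobj_quad L eps uk : 0 < eps -> exists K, forall u,
  2 * Qobj mu iota F F' alpha beta p eps uk L u =
  qform L eps uk u u - 2 * qlin L uk u + K.
Proof.
move=> e0; have [_ _ ipn] := hip; have [lin _ _] := dF.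
have si := hilbert_form hip.
exists (2 * F uk - 2 * F' uk uk + L * ip uk uk +
  2 * beta * (Psi eps uk - wform (weight eps uk) uk uk)) => u.
rewrite /Qobj (linearized_integral uk u e0).2 (linfB (lin uk).1) -!ipn.
rewrite (formBl si) !(formBr si) (formC si u uk) /qform /qlin.
by field.
Qed.

Lemma qsolve L eps uk : 0 < eps -> 0 <= L ->
  exists z, forall v, qform L eps uk z v = qlin L uk v.
Proof.
move=> e0 L0; have [_ _ ipn] := hip; have [lin _ _] := dF.
have [C C0 hC] := wform_le (weight_measurable eps uk) (weight_bound uk e0).
have si := hilbert_form hip.
apply: (@sym_lax_milgram R V (qform L eps uk) (qlin L uk) alpha
   (L + alpha + 2 * beta * C)) => //.
- exact: qform_bilinear.
- by move=> v; exact: qform_coercive.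
- by rewrite !addr_ge0 ?mulr_ge0// ltW.
- move=> v; rewrite /qform ipn [leRHS]mulrDl lerD2l -[leRHS]mulrA.
  by rewrite ler_wpM2l ?mulr_ge0// ltW.
split.
  move=> c u w; rewrite /qlin (form_linear si) (lin uk).1; ring.
have [_ [M hM]] := lin uk.
exists (L * `|uk| + M) => v; rewrite mulrDl (le_trans (ler_normB _ _))// lerD//.
by rewrite normrM ger0_norm// -mulrA ler_wpM2l// ip_norm_le.
Qed.

(** The rejection clause of [algorithmA] speaks about every minimizer of a trial problem, so it has
    content only once a minimizer exists. *)
Lemma Qmin_exists L eps uk : 0 < eps -> 0 <= L -> exists w, Qmin eps uk L w.
Proof.
move=> e0 L0; have [z hz] := qsolve uk e0 L0; exists z => u.
have [K hK] := Qobj_quad L uk e0.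
have := quad_gap u (qform_bilinear L uk e0) hz.
have := qform_coercive eps uk (u - z) L0.
have : 0 <= alpha * `|u - z| ^+ 2 by rewrite mulr_ge0 ?sqr_ge0 ?ltW.
have := hK u; have := hK z; lra.
Qed.

(** Instead of differentiating the objective, the minimizer is compared with the solution [z] of the
    linear equation: coercivity of the quadratic gap forces [w = z]. *)
Lemma Qmin_opt L eps uk w : 0 < eps -> 0 <= L -> Qmin eps uk L w ->
  forall v, qform L eps uk w v = qlin L uk v.
Proof.
move=> e0 L0 hw; have [z hz] := qsolve uk e0 L0.
have [K hK] := Qobj_quad L uk e0.
suff -> : w = z by [].
have h1 := quad_gap w (qform_bilinear L uk e0) hz.
have h2 := qform_coercive eps uk (w - z) L0.
have h3 := hw z; have h4 := hK w; have h5 := hK z.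
have : alpha * `|w - z| ^+ 2 <= 0 by lra.
rewrite pmulr_rle0// => h.
apply/eqP; rewrite -subr_eq0 -normr_eq0 -sqrf_eq0 eq_le h sqr_ge0//.
Qed.

(** Tested with [w - uk], the proximal term yields exactly [L] times the squared increment and
    cancels the last term of [condD]. Polarization turns the other products into differences of
    squares plus squares of the increment; concavity bounds the change of [Psi]. *)
Lemma energy_descent L eps uk w : 0 < eps -> 0 <= L -> Qmin eps uk L w ->
  condD F F' uk L w ->
  energy eps w + alpha / 2 * `|w - uk| ^+ 2 <= energy eps uk.
Proof.
move=> e0 L0 /(Qmin_opt e0 L0)/(_ (w - uk)); rewrite /condD /qform /qlin /energy.
have [_ _ ipn] := hip; have si := hilbert_form hip.
have sw := weight_form_linear uk e0.
have h0 : 0 <= wform (weight eps uk) (w - uk) (w - uk).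
  by apply: wform_ge0 => x; exact: weight_ge0.
have h1 := mulr_ge0 (ltW beta_gt0) h0.
have h2 : beta * Psi eps w <= beta * (Psi eps uk +
    (wform (weight eps uk) w w - wform (weight eps uk) uk uk)).
  by rewrite ler_wpM2l ?(ltW beta_gt0)// Psi_concave.
move: h1; rewrite -!ipn !(formBl si, formBr si) !(formBl sw, formBr sw).
rewrite (formC si uk w) (formC sw uk w).
move: h2; move: (Psi eps uk) (Psi eps w) (wform _ w w) (wform _ w uk)
  (wform _ uk uk) (F w) (F uk) (F' uk _) => P Q x y z f g h.
move: (ip w w) (ip w uk) (ip uk uk) => a b c.
lra.
Qed.

(** * A priori bounds along the algorithm *)

Context {eps : nat -> R} {gamma Ltil : R} {Lk : nat -> R} {u : nat -> V}.
Hypotheses (Fbd : bounded_below_affine F) (Flip : lipschitz_on_bounded F').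
Hypothesis alg : algorithmA mu iota F F' alpha beta p eps gamma Ltil Lk u.

Let eps_gt0 k : 0 < eps k. Proof. by have [[]] := alg. Qed.

Lemma cand_ge0 L : Lcand Ltil gamma L -> 0 <= L.
Proof.
have [[_ _ _ [g1 l0]] _] := alg.
case=> [->//|[l ->]]; rewrite mulr_ge0 ?exprn_ge0 ?(ltW l0)//.
by rewrite (le_trans ler01) ?ltW.
Qed.

Lemma Lk_ge0 k : 0 <= Lk k.
Proof. by have [_ /(_ k)[+ _ _ _]] := alg => /cand_ge0. Qed.

Lemma energy_mono e e' v : 0 < e' -> e' <= e -> energy e' v <= energy e v.
Proof.
move=> e0 ee; have := Psi_mono v e0 ee; rewrite /energy.
move: (Psi e' v) (Psi e v) => x y xy.
by rewrite lerD2l ler_wpM2l// ltW.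
Qed.

Lemma energy_step k :
  energy (eps k.+1) (u k.+1) + alpha / 2 * `|u k.+1 - u k| ^+ 2
  <= energy (eps k) (u k).
Proof.
have [[_ anti _ _] /(_ k)[_ hmin hD _]] := alg.
apply: le_trans (energy_descent (eps_gt0 k) (Lk_ge0 k) hmin hD).
rewrite lerD2r; exact: energy_mono.
Qed.

Lemma energy_le0 k : energy (eps k) (u k) <= energy (eps 0) (u 0).
Proof.
elim: k => [|k]; first exact: lexx.
have s0 : 0 <= alpha / 2 * `|u k.+1 - u k| ^+ 2.
  by rewrite mulr_ge0 ?sqr_ge0// divr_ge0// ltW.
have := energy_step k; move: s0; set s := alpha / 2 * _.
move: (energy _ _) (energy _ _) (energy _ _) => x y z; lra.
Qed.

(** The nonnegative penalty is dropped and only the affine minorant of [F] enters, which makes the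
    constants uniform in [e]. *)
Lemma energy_lower : exists M c, forall e v, 0 < e ->
  alpha / 2 * `|v| ^+ 2 - M * `|v| - c <= energy e v.
Proof.
have [l [c [[_ [M hM]] hF]]] := Fbd; exists M, (- c) => e v e0.
have := mulr_ge0 (ltW beta_gt0) (Psi_ge0 v e0).
have := hF v; have := hM v; rewrite ler_norml => /andP[+ _].
rewrite /energy; lra.
Qed.

Lemma iterates_bounded : exists B, forall k, `|u k| <= B.
Proof.
have [M [c low]] := energy_lower; have a0 := alpha_gt0.
pose K := `|M| + `|c + energy (eps 0) (u 0)|.
(* For a norm [x > 1] the energy bound gives [alpha / 2 * x^2 <= K * x], hence
   [x <= K / (alpha / 2)]. *)
exists (1 + K / (alpha / 2)) => k.
have a20 : 0 < alpha / 2 by rewrite divr_gt0.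
have K0 : 0 <= K by rewrite addr_ge0.
have := le_trans (low _ (u k) (eps_gt0 k)) (energy_le0 k).
move: (normr_ge0 (u k)); set x := `|u k| => x0 h.
rewrite leNgt; apply/negP => xK.
have x1 : 1 < x by rewrite (le_lt_trans _ xK)// lerDl divr_ge0// ltW.
have xK' : K < alpha / 2 * x.
  rewrite mulrC -ltr_pdivrMr// (le_lt_trans _ xK)// lerDr//.
have := ler_norm M; have := ler_norm (c + energy (eps 0) (u 0)).
have N0 := normr_ge0 (c + energy (eps 0) (u 0)).
move: xK' h N0; rewrite /K; move: (energy _ _) `|M| => E N.
move: `|c + E| a0 x1 => Q a0 x1 h1 h2 h3 h4 h5.
have : 0 <= (N - M) * x by rewrite mulr_ge0 ?subr_ge0//; lra.
have : 0 <= Q * (x - 1) by rewrite mulr_ge0//; lra.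
have : 0 < (alpha / 2 * x - (N + Q)) * x by rewrite mulr_gt0 ?subr_gt0//; lra.
lra.
Qed.

Lemma increments_cvg0 : `|u k.+1 - u k| @[k --> \oo] --> 0.
Proof.
pose E k := energy (eps k) (u k).
have a20 : 0 < alpha / 2 by rewrite divr_gt0.
have step k : alpha / 2 * `|u k.+1 - u k| ^+ 2 <= E k - E k.+1.
  by rewrite lerBrDl energy_step.
have [M [c low]] := energy_lower.
have D0 : (E k - E k.+1) @[k --> \oo] --> 0.
  (* The lower bound is the minimum of [alpha / 2 * x^2 - M * x - c] over real [x]. *)
  apply: (@nonincreasing_diff_cvg0 _ _ (- (M ^+ 2 / (2 * alpha)) - c)) => k.
    rewrite -subr_ge0 (le_trans _ (step k))//.
    by rewrite mulr_ge0 ?sqr_ge0 ?ltW.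
  apply: le_trans (low _ (u k) (eps_gt0 k)).
  have := sqr_ge0 (`|u k| - M / alpha); rewrite -(pmulr_rge0 _ a20).
  have -> : alpha / 2 * (`|u k| - M / alpha) ^+ 2 =
     alpha / 2 * `|u k| ^+ 2 - M * `|u k| + M ^+ 2 / (2 * alpha).
    by field; rewrite gt_eqF.
  lra.
apply/cvgr0Pnorm_le => e e0.
have d0 : 0 < alpha / 2 * e ^+ 2 by rewrite mulr_gt0// exprn_gt0.
move/cvgr0Pnorm_le: D0 => /(_ _ d0)[N _ hN].
exists N => // k /= Nk; rewrite normr_id -(@ler_pXn2r _ 2) ?nnegrE ?(ltW e0)//.
rewrite -(ler_pM2l a20) (le_trans (step k))// (le_trans (ler_norm _))//.
exact: hN.
Qed.

Lemma derivative_bounded : exists2 K, 0 <= K &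
  forall k v, `|F' (u k) v| <= K * `|v|.
Proof.
have [B hB] := iterates_bounded; have [lin _ _] := dF.
have [C hC] := Flip B; have [_ [M hM]] := lin (u 0%N).
exists (`|C| * (B + B) + `|M|).
  have B0 := le_trans (normr_ge0 _) (hB 0%N).
  by rewrite addr_ge0 ?mulr_ge0 ?addr_ge0.
move=> k v; rewrite -(subrK (F' (u 0%N) v) (F' (u k) v)) mulrDl.
apply: le_trans (ler_normD _ _) _; apply: lerD.
  apply: le_trans (hC _ _ (hB k) (hB 0%N) v) _; rewrite ler_wpM2r//.
  apply: (@le_trans _ _ (`|C| * `|u k - u 0%N|)); first by rewrite ler_wpM2r ?ler_norm.
  by rewrite ler_wpM2l// (le_trans (ler_normB _ _))// lerD.
by rewrite (le_trans (hM v))// ler_wpM2r// ler_norm.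
Qed.

(** Testing with [w] gives [(L + alpha) |w|^2 <= (L B + K) |w|], and [L B + K] is at most
    [(L + alpha) (B + K / alpha)]. The bound is thus uniform in [L], so a Lipschitz constant can be
    fixed before any [L] is considered. *)
Lemma trial_bounded : exists B, (forall k, `|u k| <= B) /\
  forall k L w, 0 <= L -> Qmin (eps k) (u k) L w -> `|w| <= B.
Proof.
have [B hB] := iterates_bounded; have [K K0 hK] := derivative_bounded.
have B0 := le_trans (normr_ge0 _) (hB 0%N); have [_ _ ipn] := hip.
have Ka0 : 0 <= K / alpha by rewrite divr_ge0// ltW.
exists (B + K / alpha); split=> [k|k L w L0 hw].
  by rewrite (le_trans (hB k))// lerDl.
have := Qmin_opt (eps_gt0 k) L0 hw w; rewrite /qform /qlin ipn => opt.
have h1 : 0 <= 2 * beta * wform (weight (eps k) (u k)) w w.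
  rewrite !mulr_ge0 ?(ltW beta_gt0)//.
  by apply: wform_ge0 => x; exact: weight_ge0.
have h2 : L * ip (u k) w <= L * (B * `|w|).
  rewrite ler_wpM2l// (le_trans (ler_norm _))//.
  by rewrite (le_trans (ip_norm_le _ _ hip))// ler_wpM2r.
have h3 := hK k w; rewrite ler_norml in h3; have /andP[{}h3 _] := h3.
have La : 0 < L + alpha by rewrite ltr_wpDl.
have h4 : (L + alpha) * (`|w| * `|w|) <= (L + alpha) * ((B + K / alpha) * `|w|).
  have -> : (L + alpha) * ((B + K / alpha) * `|w|) =
    L * (B * `|w|) + K * `|w| + (L * (K / alpha) * `|w| + alpha * B * `|w|).
    by field; rewrite gt_eqF.
  have h5 : 0 <= L * (K / alpha) * `|w| by rewrite mulr_ge0// mulr_ge0.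
  have h6 : 0 <= alpha * B * `|w| by rewrite !mulr_ge0 ?(ltW alpha_gt0).
  move: opt; rewrite expr2; move: h1 h2 h3 h5 h6.
  move: (_ * wform _ _ _) (L * ip _ _) (F' _ _) => *; lra.
move: h4; rewrite ler_pM2l//.
have [->|w0] := eqVneq `|w| 0; first by rewrite addr_ge0.
by rewrite ler_pM2r// lt_neqAle eq_sym w0/=.
Qed.

(* A rejected [L] lies below the Lipschitz constant of [F'] on a ball containing
   all iterates and all trial minimizers. *)
Lemma Lk_bounded : exists2 M, 0 <= M & forall k, Lk k <= M.
Proof.
have [B [hB trial]] := trial_bounded; have [C hC] := Flip B.
have [[_ _ _ [g1 l0]] step] := alg.
have g0 : 0 < gamma by rewrite (lt_trans ltr01).
(* [Lk k] is 0, or [Ltil], or [gamma] times a rejected candidate, and the latter is at most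
   [|C|]. *)
exists (Ltil + gamma * `|C|) => [|k].
  by rewrite addr_ge0 ?mulr_ge0 ?(ltW g0) ?(ltW l0).
have [cand _ _ rej] := step k.
case: cand => [->|[[|l] E]]; first by rewrite addr_ge0 ?mulr_ge0 ?(ltW g0) ?(ltW l0).
  by rewrite E expr0 mulr1 lerDl mulr_ge0 ?(ltW g0).
set L := Ltil * gamma ^+ l.
have candL : Lcand Ltil gamma L by right; exists l.
have L0 := cand_ge0 candL.
have EL : Lk k = gamma * L by rewrite E exprS /L mulrCA.
have LLk : L < Lk k by rewrite EL ltr_pMl// mulr_gt0// exprn_gt0.
have [w hw] := Qmin_exists (u k) (eps_gt0 k) L0.
have LC : L <= `|C|.
  rewrite leNgt; apply/negP => CL; apply: (rej L w candL LLk hw).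
  rewrite /condD.
  have hC' x y : `|x| <= B -> `|y| <= B ->
      forall v, `|F' x v - F' y v| <= `|C| * `|x - y| * `|v|.
    move=> xB yB v; rewrite (le_trans (hC x y xB yB v))// ler_wpM2r// ler_wpM2r//.
    exact: ler_norm.
  apply: le_trans (descent dF (normr_ge0 C) hC' (hB k) (trial k L w L0 hw)) _.
  by rewrite lerD2l ler_wpM2r ?sqr_ge0// ltW.
apply: (@le_trans _ _ (gamma * `|C|)); first by rewrite EL ler_wpM2l ?(ltW g0).
by rewrite lerDr ltW.
Qed.

(** * Passage to the limit *)

Definition pmass v : R := Rintegral mu setT (fun x => `|iota v x| `^ p).

Lemma pmass_ge0 v : 0 <= pmass v.
Proof. by apply: Rintegral_ge0 => x _; exact: powR_ge0. Qed.

Lemma pmass_int v : mu.-integrable setT (EFin \o (fun x => `|iota v x| `^ p)).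
Proof. by apply: is_L2_powR => //; exact: emb_L2. Qed.

Lemma pmass_cvg0 (y : nat -> V) : L2sq mu (iota (y n)) @[n --> \oo] --> 0 ->
  pmass (y n) @[n --> \oo] --> 0.
Proof.
move=> /cvgr0Pnorm_le y0; apply/cvgr0Pnorm_le => e e0.
have m0 : 0 < fine (mu setT) + 1 by rewrite ltr_pwDr// fine_ge0.
(* [eta] is chosen first, so that [eta ^ p] times the total measure is at most [e / 2]; the L^2 term
   is then made small for this fixed [eta]. The added 1 covers measure zero. *)
pose a := e / (2 * (fine (mu setT) + 1)).
have a0 : 0 < a by rewrite divr_gt0// mulr_gt0.
pose eta := a `^ p^-1; have eta0 : 0 < eta by rewrite powR_gt0.
have etap : eta `^ p = a by rewrite -powRrM mulVf ?gt_eqF// powRr1// ltW.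
have am : a * fine (mu setT) <= e / 2.
  have -> : e / 2 = a * (fine (mu setT) + 1) by rewrite /a; field; rewrite gt_eqF.
  by rewrite ler_wpM2l ?(ltW a0)// lerDl.
have k0 : 0 < eta `^ (p - 2) by rewrite powR_gt0.
have /y0 : 0 < e / 2 / eta `^ (p - 2) by rewrite !divr_gt0.
apply: filterS => n /(le_trans (ler_norm _)).
rewrite ler_pdivlMr// mulrC => h.
rewrite ger0_norm ?pmass_ge0//.
apply: le_trans (Rintegral_powR_le p_gt0 p_lt1 mu_fin eta0 (emb_L2 (y n))) _.
by rewrite etap (splitr e) lerD.
Qed.

(** The bound stays useful as [e] tends to 0, although the upper bound for the weight blows up: all
    subtracted terms vanish when [a] and [b] approach [c] in L^2. *)
Lemma wform_lower e (a b c : V) : 0 < e ->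
  p * pmass c - 2 * pmass (b - c) - (2 - p) * pmass (a - c)
    - (2 - p) * e `^ p * fine (mu setT) <=
  2 * wform (weight e a) b b.
Proof.
move=> e0; have ic := pmass_int c; have ib := pmass_int (b - c).
have ia := pmass_int (a - c); have iw := weight_int a b b e0.
have ik := intble_cst mu_fin ((2 - p) * e `^ p).
have j1 := intbleB (intbleZ p ic) (intbleZ 2 ib).
have j2 := intbleB j1 (intbleZ (2 - p) ia).
rewrite /wform /pmass -Rintegral_cst// -!RintegralZl//.
rewrite -RintegralB//; try exact: intbleZ.
rewrite -RintegralB//; try exact: intbleZ.
rewrite -RintegralB//.
apply: le_Rintegral => //; [exact: intbleB|exact: intbleZ|].
by move=> x _; rewrite !embB -expr2; exact: dpsi_mul_ge.
Qed.

Hypothesis Fcc : completely_continuous ip F'.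

(** The right-hand side is [beta] times the value at [ubar] of the multiplier defined by the limit
    equation. *)
Lemma limit_inequality (phi : nat -> nat) ubar :
  (forall n, (phi n < phi n.+1)%N) -> weak_cvg ip (fun n => u (phi n)) ubar ->
  beta * (p * pmass ubar) <= - F' ubar ubar - alpha * ip ubar ubar.
Proof.
move=> hphi uw0; have [B hB] := iterates_bounded.
have B0 := le_trans (normr_ge0 _) (hB 0%N).
(* A further subsequence converges strongly in L^2; its limit is still [ubar]. *)
have [chi hchi D0] := compact_weak_cvg uw0 (ex_intro _ B (fun n => hB (phi n))).
have uw := weak_cvg_sub hchi uw0.
pose s n := phi (chi n).
have s_oo : s n @[n --> \oo] --> \oo.
  exact: (cvg_comp _ _ (cvg_increasing hchi) (cvg_increasing hphi)).
have [_ [_ _ [C hC] _ _]] := hemb.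
have [_ _ ipn] := hip; have si := hilbert_form hip; have [lin _ _] := dF.
have d0 : `|u (s n).+1 - u (s n)| @[n --> \oo] --> 0.
  exact: (cvg_comp _ _ s_oo increments_cvg0).
have cst_d0 k : k * `|u (s n).+1 - u (s n)| @[n --> \oo] --> 0.
  by rewrite -(mulr0 k); exact: cvgMl_tmp.
(* The successors [u (s n).+1] need not belong to the subsequence; they share its weak limit because
   the increments vanish. *)
have uw1 : weak_cvg ip (fun n => u (s n).+1) ubar.
  move=> v; have h0 : ip (u (s n).+1 - u (s n)) v @[n --> \oo] --> 0.
    apply: cvg0_le (cst_d0 `|v|) => n.
    by rewrite mulrC; exact: ip_norm_le.
  rewrite (_ : (fun n => ip (u (s n).+1) v) =
    (fun n => ip (u (s n)) v + ip (u (s n).+1 - u (s n)) v)).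
    by rewrite -[ip ubar v]addr0; exact: cvgD (uw v) h0.
  by apply/funext => n; rewrite -(formDl si) addrC subrK.
have D1 : L2sq mu (iota (u (s n).+1 - ubar)) @[n --> \oo] --> 0.
  have h : 2 * L2sq mu (iota (u (s n) - ubar)) +
      2 * (C * (`|u (s n).+1 - u (s n)| * `|u (s n).+1 - u (s n)|)) @[n --> \oo] --> 0.
    rewrite -[0]addr0 -[X in X + 0](mulr0 2) -[X in _ + X](mulr0 2).
    apply: cvgD; first exact: cvgMl_tmp.
    apply: cvgMl_tmp; rewrite -(mulr0 C); apply: cvgMl_tmp.
    by rewrite -(mulr0 0); exact: cvgM.
  apply: cvg0_le h => n.
  rewrite ger0_norm; last by apply: Rintegral_ge0 => x _; exact: sqr_ge0.
  rewrite -expr2 (_ : u (s n).+1 - ubar = (u (s n) - ubar) + (u (s n).+1 - u (s n))).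
    by apply: le_trans (L2sqD_le _ _) _; rewrite lerD2l ler_wpM2l.
  by rewrite [RHS]addrC addrA subrK.
have P0 : pmass (u (s n) - ubar) @[n --> \oo] --> 0 by exact: pmass_cvg0 D0.
have P1 := pmass_cvg0 D1.
have E0 : (eps (s n)) `^ p @[n --> \oo] --> 0.
  apply: powR_seq_cvg0 => // [n|]; first by rewrite ltW.
  by have [[_ _ e0 _] _] := alg; exact: (cvg_comp _ _ s_oo e0).
(* Derivative and argument both vary: complete continuity handles the former uniformly on bounded
   arguments, weak convergence the latter. *)
have Fs : F' (u (s n)) (u (s n).+1) @[n --> \oo] --> F' ubar ubar.
  have h0 : (F' (u (s n)) (u (s n).+1) - F' ubar (u (s n).+1)) @[n --> \oo] --> 0.
    apply/cvgr0Pnorm_le => e e0.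
    have B1 : 0 < B + 1 by rewrite ltr_pwDr.
    have [N hN] := Fcc uw (divr_gt0 e0 B1).
    exists N => // n /= Nn; apply: le_trans (hN n Nn _) _.
    rewrite -mulrA ger_pMr// mulrC ler_pdivrMr// mul1r (le_trans (hB _))// lerDl//.
  rewrite (_ : (fun n => F' (u (s n)) (u (s n).+1)) = (fun n =>
    (F' (u (s n)) (u (s n).+1) - F' ubar (u (s n).+1)) + F' ubar (u (s n).+1))).
    by rewrite -[F' ubar ubar]add0r; exact: cvgD h0 (weak_cvg_dual hip (lin ubar) uw1).
  by apply/funext => n; rewrite subrK.
have [M M0 hM] := Lk_bounded.
have Ls : Lk (s n) * ip (u (s n).+1 - u (s n)) (u (s n).+1) @[n --> \oo] --> 0.
  apply: cvg0_le (cst_d0 (M * B)) => n; rewrite normrM ger0_norm ?Lk_ge0//.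
  rewrite -mulrA ler_pM ?Lk_ge0// (le_trans (ip_norm_le _ _ hip))// mulrC.
  by rewrite ler_wpM2r.
(* Only weak convergence in V is available, so the squared norm of [w = u (s n).+1] is replaced by
   its minorant [2 * ip w ubar - ip ubar ubar], which is affine in [w] and has the right limit. *)
pose rhs n := beta * (2 * pmass (u (s n).+1 - ubar)
    + (2 - p) * pmass (u (s n) - ubar) + (2 - p) * fine (mu setT) * eps (s n) `^ p)
    - F' (u (s n)) (u (s n).+1)
    - Lk (s n) * ip (u (s n).+1 - u (s n)) (u (s n).+1)
    - alpha * (2 * ip (u (s n).+1) ubar - ip ubar ubar).
have key n : beta * (p * pmass ubar) <= rhs n.
  rewrite /rhs.
  have [_ /(_ (s n))[_ hmin _ _]] := alg.
  have := Qmin_opt (eps_gt0 _) (Lk_ge0 _) hmin (u (s n).+1).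
  rewrite /qform /qlin (formBl si) => opt.
  have h1 := wform_lower (u (s n)) (u (s n).+1) ubar (eps_gt0 (s n)).
  have h2 : 0 <= ip (u (s n).+1 - ubar) (u (s n).+1 - ubar) by rewrite ipn sqr_ge0.
  have {}h2 := mulr_ge0 (ltW alpha_gt0) h2.
  rewrite (formBl si) !(formBr si) (formC si ubar (u _)) in h2.
  rewrite -subr_ge0 in h1; have {}h1 := mulr_ge0 (ltW beta_gt0) h1.
  move: h1 h2 opt.
  move: (wform _ _ _) (pmass _) (pmass _) (pmass _) (eps _ `^ _)
    (fine _) (F' _ _) => ? ? ? ? ? ? ? h1 h2 opt; lra.
have rhs_cvg : rhs n @[n --> \oo] --> beta * (2 * 0 + (2 - p) * 0 +
    (2 - p) * fine (mu setT) * 0) - F' ubar ubar - 0 -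
    alpha * (2 * ip ubar ubar - ip ubar ubar).
  apply: cvgB; last first.
    apply: cvgMl_tmp; apply: cvgB; last exact: cvg_cst.
    by apply: cvgMl_tmp; exact: uw1.
  apply: cvgB; last exact: Ls.
  apply: cvgB; last exact: Fs.
  apply: cvgMl_tmp; apply: cvgD; last exact: cvgMl_tmp.
  by apply: cvgD; apply: cvgMl_tmp; [exact: P1|exact: P0].
have := cvgr_to_ge rhs_cvg (nearW _ key).
rewrite !mulr0 !addr0 mulr0 sub0r subr0 mulr_natl mulr2n addrK.
by apply.
Qed.

End Subproblem.

Theorem theorem7p8 (R : realType)
  (* Omega, as a finite measure space *)
  (d : measure_display) (T : measurableType d) (mu : {measure set T -> \bar R})
  (hmu : (mu setT < +oo)%E)
  (* V: real Hilbert space, compactly and densely embedded in L^2(Omega) *)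
  (V : completeNormedModType R) (ip : V -> V -> R) (iota : V -> T -> R)
  (hip : is_hilbert_ip ip) (hemb : compact_dense_embedding mu iota)
  (* F with derivative F' : V -> V^* *)
  (F : V -> R) (F' : V -> V -> R)
  (hFlsc : weakly_lsc ip F) (hFbd : bounded_below_affine F)
  (hFdiff : cont_frechet F F')
  (* Assumption (I) *)
  (hF'cc : completely_continuous ip F') (hF'lip : lipschitz_on_bounded F')
  (alpha beta p : R) (halpha : 0 < alpha) (hbeta : 0 < beta)
  (hp0 : 0 < p) (hp1 : p < 1)
  (* Algorithm A *)
  (eps : nat -> R) (gamma Ltil : R) (Lk : nat -> R) (u : nat -> V)
  (halg : algorithmA mu iota F F' alpha beta p eps gamma Ltil Lk u)
  (* weak limit of a subsequence *)
  (ubar : V) (phi : nat -> nat) (hphi : forall n, (phi n < phi n.+1)%N)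
  (hweak : weak_cvg ip (fun n => u (phi n)) ubar) :
  exists lam : V -> R,
    [/\ is_dual lam,
        (forall v, alpha * ip ubar v + beta * lam v = - F' ubar v)
      & p * Rintegral mu setT (fun x => `|iota ubar x| `^ p) <= lam ubar].
Proof.
have [lin _ _] := hFdiff; have [Flin [M hM]] := lin ubar.
have si := hilbert_form hip.
(* The limit equation solved for the multiplier. *)
exists (fun v => (- F' ubar v - alpha * ip ubar v) / beta); split.
- split=> [c v w|]; first by rewrite Flin (form_linear si); ring.
  exists ((M + alpha * `|ubar|) / beta) => v.
  rewrite normrM normfV (gtr0_norm hbeta) [leRHS]mulrAC ler_pM2r ?invr_gt0//.
  rewrite (le_trans (ler_normB _ _))// normrN mulrDl lerD//.
  by rewrite normrM gtr0_norm// -mulrA ler_pM2l// ip_norm_le.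
- by move=> v; field; rewrite gt_eqF.
- rewrite ler_pdivlMr// mulrC.
  exact: (limit_inequality hip hemb hmu hFdiff halpha hbeta hp0 hp1
    hFbd hF'lip halg hF'cc hphi hweak).
Qed.
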